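(* For all integers $n\ge 2$, the $n$-th tangent number $T_n$ is an even integer and is not divisible by $3$. Moreover, for any integer $n\ge 1$, $$T_n\equiv\begin{cases}1 \pmod 3 & \text{if } n \text{ is odd},\\ 2 \pmod 3 & \text{if } n\text{ is even}.\end{cases}$$
   Context: For $n\ge1$, the $n$-th tangent number is $T_n:=(-1)^n2^{2n}(1-2^{2n})\frac{B_{2n}}{2n}$, where $B_n$ is the $n$-th Bernoulli number, defined by $\frac{t}{e^t-1}=\sum_{n\ge0}B_n\frac{t^n}{n!}$. Equivalently, $\tan x=\sum_{n\ge1}T_n\frac{x^{2n-1}}{(2n-1)!}$ around $x=0$. It is a known fact that every $T_n$ is an integer. *)

(* Defs.v *)
From Stdlib Require Import Reals Lra Lia ZArith Arith ClassicalEpsilon.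
From Coquelicot Require Import Coquelicot.
Open Scope R_scope.

(** [t / (exp t - 1) = sum_n B n * t^n / n!] on a punctured neighbourhood of 0;
    the point [t = 0] is excluded because there the quotient reads
    [0 / 0]. *)
Definition bernoulli_gf (B : nat -> R) : Prop :=
  locally' (0 : R) (fun t : R =>
    is_pseries (fun n : nat => B n / INR (fact n)) t (t / (exp t - 1))).

(** The Bernoulli numbers (with [bernoulli 1 = - 1 / 2]).  The choice operator
    is harmless: [bernoulli_gf_exists] and [bernoulli_gf_unique] below show that
    exactly one sequence satisfies [bernoulli_gf]. *)
Definition bernoulli : nat -> R :=
  epsilon (inhabits (fun _ : nat => 0)) bernoulli_gf.

Definition tangent_number (n : nat) : R :=
  (-1) ^ n * 2 ^ (2 * n) * (1 - 2 ^ (2 * n)) * (bernoulli (2 * n) / INR (2 * n)).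

Lemma exp_sub1_neq0 (t : R) : t <> 0 -> exp t - 1 <> 0.
Proof.
  intros Ht H. apply Ht. apply exp_inv. rewrite exp_0. lra.
Qed.

Lemma bernoulli_gf_CV_radius (B : nat -> R) :
  bernoulli_gf B -> Rbar_lt 0 (CV_radius (fun n => B n / INR (fact n))).
Proof.
  intros [d Hd].
  assert (Hd0 := cond_pos d).
  assert (Hs : is_pseries (fun n => B n / INR (fact n)) (d / 2)
                 (d / 2 / (exp (d / 2) - 1))).
  { apply Hd; [|lra].
    change (Rabs (d / 2 - 0) < d). rewrite Rabs_pos_eq; lra. }
  apply Rbar_lt_le_trans with (Rabs (d / 2)).
  { simpl. rewrite Rabs_pos_eq; lra. }
  apply Rbar_not_lt_le. intro Hlt.
  apply (CV_disk_outside _ _ Hlt).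
  apply ex_series_lim_0. eexists.
  apply (is_series_ext _ _ _ (fun n => eq_trans (f_equal2 Rmult (pow_n_pow _ n) eq_refl)
                                          (Rmult_comm _ _)) Hs).
Qed.

Theorem bernoulli_gf_unique (B B' : nat -> R) :
  bernoulli_gf B -> bernoulli_gf B' -> forall n, B n = B' n.
Proof.
  intros H H' n.
  set (b := fun n => B n / INR (fact n)). set (b' := fun n => B' n / INR (fact n)).
  assert (E : PS_incr_1 b (S n) = PS_incr_1 b' (S n)).
  { apply PSeries_ext_recip.
    - rewrite CV_radius_incr_1. now apply bernoulli_gf_CV_radius.
    - rewrite CV_radius_incr_1. now apply bernoulli_gf_CV_radius.
    - generalize (filter_and (F := locally (0 : R)) _ _ H H').
      apply filter_imp. intros t [Ht Ht'].
      rewrite !PSeries_incr_1.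
      destruct (Req_dec t 0) as [-> | Hn]; [ring|].
      f_equal. exact (eq_trans (is_pseries_unique _ _ _ (Ht Hn))
                        (eq_sym (is_pseries_unique _ _ _ (Ht' Hn)))). }
  simpl in E. unfold b, b' in E.
  assert (Hf := INR_fact_neq_0 n).
  apply Rmult_eq_reg_r with (/ INR (fact n)); [exact E | now apply Rinv_neq_0_compat].
Qed.

Definition exp1_coef (n : nat) : R := / INR (fact (S n)).

Fixpoint inv_coef_upto (n : nat) : nat -> R :=
  match n with
  | O => fun k => if Nat.eqb k 0 then 1 else 0
  | S m => fun k =>
      if Nat.eqb k (S m)
      then - sum_f_R0 (fun j => inv_coef_upto m j * exp1_coef (S m - j)) m
      else inv_coef_upto m k
  end.

(** Coefficients of the formal inverse of [(exp t - 1) / t]; used only to show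
    that [bernoulli_gf] is satisfiable. *)
Definition inv_coef (n : nat) : R := inv_coef_upto n n.

Lemma inv_coef_upto_le (m k : nat) : (k <= m)%nat -> inv_coef_upto m k = inv_coef k.
Proof.
  induction m as [|m IH]; intro Hk.
  - now replace k with 0%nat by lia.
  - destruct (Nat.eq_dec k (S m)) as [-> | Hn]; [reflexivity|].
    cbn [inv_coef_upto]. rewrite (proj2 (Nat.eqb_neq _ _) Hn). apply IH; lia.
Qed.

Lemma inv_coef_S (m : nat) :
  inv_coef (S m) = - sum_f_R0 (fun j => inv_coef j * exp1_coef (S m - j)) m.
Proof.
  unfold inv_coef at 1. cbn [inv_coef_upto]. rewrite Nat.eqb_refl.
  f_equal. apply sum_eq. intros i Hi. now rewrite inv_coef_upto_le.
Qed.

Lemma exp1_coef_0 : exp1_coef 0 = 1.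
Proof. unfold exp1_coef; simpl; lra. Qed.

Lemma inv_coef_mult (n : nat) :
  PS_mult inv_coef exp1_coef n = (if Nat.eqb n 0 then 1 else 0).
Proof.
  unfold PS_mult. destruct n as [|n].
  - cbn. rewrite exp1_coef_0. unfold inv_coef; simpl; lra.
  - cbn [sum_f_R0 Nat.eqb]. rewrite Nat.sub_diag, exp1_coef_0, inv_coef_S. lra.
Qed.

Lemma exp1_coef_bound (n : nat) : 0 <= exp1_coef n <= (1 / 2) ^ n.
Proof.
  induction n as [|n [IH0 IH]]; [rewrite exp1_coef_0; simpl; lra|].
  assert (E : exp1_coef (S n) = / INR (S (S n)) * exp1_coef n).
  { unfold exp1_coef. rewrite (fact_simpl (S n)), mult_INR, Rinv_mult. reflexivity. }
  rewrite E. change ((1 / 2) ^ S n) with (1 / 2 * (1 / 2) ^ n).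
  assert (H2 : 2 <= INR (S (S n))) by (rewrite !S_INR; generalize (pos_INR n); lra).
  assert (0 < / INR (S (S n))) by (apply Rinv_0_lt_compat; lra).
  assert (/ INR (S (S n)) <= 1 / 2)
    by (replace (1 / 2) with (/ 2) by lra; apply Rinv_le_contravar; lra).
  split; [apply Rmult_le_pos; lra | apply Rmult_le_compat; lra].
Qed.

Lemma sum_half (n : nat) : sum_f_R0 (fun j => (1 / 2) ^ (S n - j)) n = 1 - (1 / 2) ^ S n.
Proof.
  induction n as [|n IH]; [simpl; lra|].
  cbn [sum_f_R0].
  rewrite (sum_eq _ (fun j => (1 / 2) ^ (S n - j) * (1 / 2))).
  2:{ intros i Hi. replace (S (S n) - i)%nat with (S (S n - i)) by lia. simpl; ring. }
  rewrite <- scal_sum, IH. replace (S (S n) - S n)%nat with 1%nat by lia.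
  simpl; lra.
Qed.

Lemma inv_coef_bound (n : nat) : Rabs (inv_coef n) <= 1.
Proof.
  induction n as [n IH] using lt_wf_ind. destruct n as [|n].
  - unfold inv_coef; simpl. rewrite Rabs_R1; lra.
  - rewrite inv_coef_S, Rabs_Ropp.
    eapply Rle_trans; [apply Rsum_abs|].
    apply Rle_trans with (sum_f_R0 (fun j => (1 / 2) ^ (S n - j)) n).
    + apply sum_Rle. intros j Hj. rewrite Rabs_mult.
      destruct (exp1_coef_bound (S n - j)) as [H0 H1].
      rewrite (Rabs_pos_eq (exp1_coef _)) by assumption.
      rewrite <- (Rmult_1_l ((1 / 2) ^ _)).
      apply Rmult_le_compat; try assumption; [apply Rabs_pos | apply IH; lia].
    + rewrite sum_half. assert (0 < (1 / 2) ^ S n) by (apply pow_lt; lra). lra.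
Qed.

Lemma CV_radius_ge1 (a : nat -> R) :
  (forall n, Rabs (a n) <= 1) -> Rbar_le 1 (CV_radius a).
Proof.
  intro Ha. apply (CV_radius_bounded a). exists 1. intro n.
  now rewrite pow1, Rmult_1_r.
Qed.

Theorem bernoulli_gf_exists : exists B, bernoulli_gf B.
Proof.
  exists (fun n => inv_coef n * INR (fact n)).
  exists (mkposreal 1 Rlt_0_1). intros t Ht Ht0.
  change (Rabs (t - 0) < 1) in Ht. rewrite Rminus_0_r in Ht.
  apply (is_series_ext (fun n => scal (pow_n t n) (inv_coef n))).
  { intro n. f_equal. field. apply INR_fact_neq_0. }
  assert (Hc : Rbar_lt (Rabs t) (CV_radius inv_coef)).
  { apply Rbar_lt_le_trans with 1; [exact Ht|].
    apply CV_radius_ge1, inv_coef_bound. }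
  assert (He : Rbar_lt (Rabs t) (CV_radius exp1_coef)).
  { apply Rbar_lt_le_trans with 1; [exact Ht|].
    apply CV_radius_ge1. intro n. destruct (exp1_coef_bound n) as [H0 H1].
    rewrite Rabs_pos_eq by assumption. eapply Rle_trans; [exact H1|].
    apply Rle_trans with (1 ^ n); [apply pow_incr; lra | rewrite pow1; lra]. }
  assert (Hm := PSeries_mult _ _ _ Hc He).
  rewrite (PSeries_ext _ _ t inv_coef_mult) in Hm.
  assert (H1 : PSeries (fun n => if Nat.eqb n 0 then 1 else 0) t = 1).
  { rewrite PSeries_decr_1.
    - rewrite (PSeries_ext _ (fun _ => 0)) by reflexivity.
      rewrite PSeries_const_0. simpl; ring.
    - apply CV_radius_inside, Rbar_lt_le_trans with 1; [exact Ht|].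
      apply CV_radius_ge1. intros [|n]; simpl; rewrite ?Rabs_R1, ?Rabs_R0; lra. }
  assert (H2 : t * PSeries exp1_coef t = exp t - 1).
  { rewrite exp_Reals, (PSeries_decr_1 (fun n => / INR (fact n)))
      by (eexists; apply is_exp_Reals).
    simpl. rewrite (PSeries_ext exp1_coef (PS_decr_1 (fun n => / INR (fact n))))
      by reflexivity. lra. }
  rewrite H1 in Hm.
  replace (t / (exp t - 1)) with (PSeries inv_coef t).
  - apply PSeries_correct, CV_radius_inside, Hc.
  - assert (Hx := exp_sub1_neq0 t Ht0).
    apply Rmult_eq_reg_r with (exp t - 1); [|assumption].
    rewrite <- H2 at 1. field_simplify; [|assumption].
    replace (PSeries inv_coef t * t * PSeries exp1_coef t)
      with (t * (PSeries inv_coef t * PSeries exp1_coef t)) by ring.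
    rewrite <- Hm; ring.
Qed.

Theorem bernoulliP : bernoulli_gf bernoulli.
Proof. unfold bernoulli. apply epsilon_spec, bernoulli_gf_exists. Qed.

(* Main.v *)
Require Import Defs.
From Stdlib Require Import Reals ZArith Arith.
From Stdlib Require Import Lra Lia.
From Coquelicot Require Import Coquelicot.
Open Scope R_scope.

(** Up to sign, [T_n] is the derivative of order [2n - 1] of [tanh] at [0]
    ([tangent_number_tanh]).  Indeed, writing [f t = t / (exp t - 1)], the even
    part of [f] at [2t] is [t * coth t], so [tanh t = 2 coth (2t) - coth t]
    makes [t * tanh t] the even part of [f (4t) - f (2t)]; its Taylor
    coefficients are therefore explicit in the Bernoulli numbers.

    The congruences come from the differential equation [y' = 1 - y^2] of
    [y = tanh].  All derivatives of [y] are integral polynomials in [y], hence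
    are integers at [0], where [y] vanishes.  Differentiating once more,
    [y'' = -2 y y'] is twice such a polynomial, and so are all later
    derivatives: this gives evenness.  Differentiating again,
    [y''' = -2 y' + 6 y^2 y'] is congruent to [y'] modulo 3, so by induction all
    derivatives of odd order are congruent to [y'], whose value at [0] is [1]:
    hence [T_n] is congruent to [(-1)^(n+1)] modulo 3. *)

(** * Integral polynomials in tanh *)

(** The functions [p (tanh x)] with [p] an integral polynomial, generated without
    naming the polynomials: only stability under differentiation and
    integrality at [0] matter. *)
Inductive Ztanh : (R -> R) -> Prop :=
| Ztanh_const (z : Z) : Ztanh (fun _ => IZR z)
| Ztanh_tanh : Ztanh tanh
| Ztanh_plus (f g : R -> R) : Ztanh f -> Ztanh g -> Ztanh (fun x => f x + g x)
| Ztanh_mult (f g : R -> R) : Ztanh f -> Ztanh g -> Ztanh (fun x => f x * g x).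

Lemma tanh_0 : tanh 0 = 0.
Proof. unfold tanh. rewrite sinh_0, cosh_0. lra. Qed.

Lemma cosh_pos (x : R) : 0 < cosh x.
Proof.
  unfold cosh. generalize (exp_pos x) (exp_pos (- x)). lra.
Qed.

Lemma is_derive_tanh (x : R) : is_derive tanh x (1 - tanh x * tanh x).
Proof.
  assert (H := cosh_pos x). unfold tanh, sinh, cosh in *.
  auto_derive; [lra|]. field. lra.
Qed.

Lemma Ztanh_at_0 (f : R -> R) : Ztanh f -> exists z : Z, f 0 = IZR z.
Proof.
  induction 1 as [z | | f g _ [a Ha] _ [b Hb] | f g _ [a Ha] _ [b Hb]].
  - now exists z.
  - exists 0%Z. apply tanh_0.
  - exists (a + b)%Z. now rewrite plus_IZR, Ha, Hb.
  - exists (a * b)%Z. now rewrite mult_IZR, Ha, Hb.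
Qed.

Lemma Ztanh_derive (f : R -> R) :
  Ztanh f -> exists g, Ztanh g /\ forall x, is_derive f x (g x).
Proof.
  induction 1 as [z | | f g Hf [f' [Kf Df]] Hg [g' [Kg Dg]]
                     | f g Hf [f' [Kf Df]] Hg [g' [Kg Dg]]].
  - exists (fun _ => IZR 0). split; [constructor|].
    intro x. apply (is_derive_const (IZR z) x).
  - exists (fun x => 1 + IZR (-1) * (tanh x * tanh x)). split.
    + repeat first [apply (Ztanh_const 1) | constructor].
    + intro x. replace (1 + _) with (1 - tanh x * tanh x) by ring.
      apply is_derive_tanh.
  - exists (fun x => f' x + g' x). split; [now constructor|].
    intro x. apply (is_derive_plus f g); auto.
  - exists (fun x => f' x * g x + f x * g' x). split; [now repeat constructor|].
    intro x. now apply Derive.is_derive_mult.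
Qed.

(** The eta-expanded form is the one that [auto_derive] leaves in its output. *)
Lemma Derive_eta (f : R -> R) (x l : R) :
  is_derive f x l -> Derive (fun y => f y) x = l.
Proof. apply is_derive_unique. Qed.

(** [tanh'' = -2 tanh tanh'], and the factor 2 survives differentiation. *)
Lemma Derive_n_tanh_even (n : nat) :
  exists q, Ztanh q /\ forall x, Derive_n tanh (S (S n)) x = 2 * q x.
Proof.
  induction n as [|n [q [Kq Dq]]].
  - exists (fun x => IZR (-1) * (tanh x * (1 + IZR (-1) * (tanh x * tanh x)))).
    split; [repeat first [apply (Ztanh_const 1) | constructor]|].
    intro x. cbn [Derive_n].
    rewrite (Derive_ext _ (fun x => 1 - tanh x * tanh x))
      by (intro; apply is_derive_unique, is_derive_tanh).
    apply is_derive_unique.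
    auto_derive; [repeat split; eexists; apply is_derive_tanh|].
    rewrite (Derive_eta _ _ _ (is_derive_tanh x)). ring.
  - destruct (Ztanh_derive q Kq) as [q' [Kq' Dq']].
    exists q'. split; [assumption|].
    intro x. change (Derive_n tanh (S (S (S n))) x)
      with (Derive (Derive_n tanh (S (S n))) x).
    rewrite (Derive_ext _ _ x Dq).
    apply is_derive_unique, is_derive_scal, Dq'.
Qed.

(** With [u = tanh' = 1 - tanh^2], one has [u'' = u + 3 (2 tanh^2 u - u)], so two
    differentiations preserve the class of [u] modulo 3. *)
Lemma Derive_n_tanh_mod3 (n : nat) :
  exists q, Ztanh q /\
    forall x, Derive_n tanh (S (2 * n)) x = 1 - tanh x * tanh x + 3 * q x.
Proof.
  induction n as [|n [q [Kq Dq]]].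
  - exists (fun _ => IZR 0). split; [constructor|].
    intro x. simpl Derive_n.
    rewrite (Derive_eta _ _ _ (is_derive_tanh x)). ring.
  - destruct (Ztanh_derive q Kq) as [q1 [Kq1 Dq1]].
    destruct (Ztanh_derive q1 Kq1) as [q2 [Kq2 Dq2]].
    exists (fun x => (1 + IZR (-1) * (tanh x * tanh x))
                     * (2 * (tanh x * tanh x) + IZR (-1)) + q2 x).
    split; [repeat first [assumption | apply (Ztanh_const 1)
                          | apply (Ztanh_const 2) | constructor]|].
    intro x. replace (S (2 * S n)) with (S (S (S (2 * n)))) by lia.
    change (Derive_n tanh (S (S (S (2 * n)))) x)
      with (Derive (Derive (Derive_n tanh (S (2 * n)))) x).
    rewrite (Derive_ext _ (fun x => -2 * tanh x * (1 - tanh x * tanh x) + 3 * q1 x)).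
    2:{ intro y. rewrite (Derive_ext _ _ y Dq). apply is_derive_unique.
        auto_derive;
          [repeat split; eexists; first [apply is_derive_tanh | apply Dq1]|].
        rewrite (Derive_eta _ _ _ (is_derive_tanh y)),
          (Derive_eta _ _ _ (Dq1 y)). ring. }
    apply is_derive_unique.
    auto_derive; [repeat split; eexists; first [apply is_derive_tanh | apply Dq2]|].
    rewrite (Derive_eta _ _ _ (is_derive_tanh x)),
      (Derive_eta _ _ _ (Dq2 x)). ring.
Qed.

(** * Bernoulli numbers and the Taylor series of tanh *)

Lemma CV_radius_pos_of_locally' (a : nat -> R) :
  locally' (0 : R) (fun t : R => ex_pseries a t) -> Rbar_lt 0 (CV_radius a).
Proof.
  intros [d Hd].
  assert (Hd0 := cond_pos d).
  assert (Hs : ex_pseries a (d / 2)).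
  { apply Hd; [|lra].
    change (Rabs (d / 2 - 0) < d). rewrite Rabs_pos_eq; lra. }
  apply Rbar_lt_le_trans with (Rabs (d / 2)).
  { simpl. rewrite Rabs_pos_eq; lra. }
  apply Rbar_not_lt_le. intro Hlt.
  apply (CV_disk_outside _ _ Hlt), ex_series_lim_0, ex_pseries_R, Hs.
Qed.

Lemma is_pseries_comp_scal (a : nat -> R) (k t l : R) :
  is_pseries a (k * t) l -> is_pseries (fun n => k ^ n * a n) t l.
Proof.
  unfold is_pseries. apply is_series_ext. intro n.
  rewrite !pow_n_pow, Rpow_mult_distr.
  change (k ^ n * t ^ n * a n = t ^ n * (k ^ n * a n)). ring.
Qed.

Lemma is_pseries_even_part (a : nat -> R) (t l l' : R) :
  is_pseries a t l -> is_pseries a (- t) l' ->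
  is_pseries (fun n => (1 + (-1) ^ n) / 2 * a n) t ((l + l') / 2).
Proof.
  intros H H'. replace (- t) with (-1 * t) in H' by ring.
  apply is_pseries_comp_scal in H'.
  generalize (is_pseries_scal (/ 2) _ _ _ (Rmult_comm _ _)
                (is_pseries_plus _ _ _ _ _ H H')).
  replace ((l + l') / 2) with (scal (/ 2) (plus l l'))
    by (change (/ 2 * (l + l') = (l + l') / 2); field).
  apply is_series_ext. intro n. f_equal.
  change (/ 2 * (a n + (-1) ^ n * a n) = (1 + (-1) ^ n) / 2 * a n). field.
Qed.

(** The index is shifted because the Bernoulli series yields [t * tanh t]; the
    factor [(1 + (-1) ^ S n) / 2] selects its even part. *)
Definition tanh_coef (n : nat) : R :=
  (4 ^ S n - 2 ^ S n) * ((1 + (-1) ^ S n) / 2 * (bernoulli (S n) / INR (fact (S n)))).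

Lemma exp_INR_mult (n : nat) (t : R) : exp (INR n * t) = exp t ^ n.
Proof.
  induction n as [|n IH]; [now rewrite Rmult_0_l, exp_0|].
  rewrite S_INR, Rmult_plus_distr_r, Rmult_1_l, exp_plus, IH. simpl; ring.
Qed.

(** This is [tanh t = 2 coth (2t) - coth t] multiplied by [t]: with
    [f t = t / (exp t - 1)], the average of [f (2t)] and [f (- 2t)] is
    [t * coth t], since [f (- 2t) = f (2t) + 2t]. *)
Lemma mul_tanh_gf (t : R) : t <> 0 ->
  (4 * t / (exp (4 * t) - 1) + - (4 * t) / (exp (- (4 * t)) - 1)) / 2
  - (2 * t / (exp (2 * t) - 1) + - (2 * t) / (exp (- (2 * t)) - 1)) / 2
  = t * tanh t.
Proof.
  intro Ht. unfold tanh, sinh, cosh. rewrite !exp_Ropp.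
  assert (H2 := exp_sub1_neq0 (2 * t) ltac:(lra)).
  assert (E4 : exp (4 * t) = exp t ^ 4)
    by (replace 4 with (INR 4) by (simpl; ring); apply exp_INR_mult).
  assert (E2 : exp (2 * t) = exp t ^ 2)
    by (replace 2 with (INR 2) by (simpl; ring); apply exp_INR_mult).
  rewrite E2 in H2. rewrite E2, E4.
  assert (He := exp_pos t). revert H2 He. generalize (exp t). intros e H2 He.
  assert (0 < e ^ 2) by (apply pow_lt; lra).
  assert (H4 : e ^ 4 - 1 <> 0).
  { replace (e ^ 4 - 1) with ((e ^ 2 - 1) * (e ^ 2 + 1)) by ring.
    apply Rmult_integral_contrapositive_currified; lra. }
  field; repeat split; nra.
Qed.

Lemma locally'_0_scal (k : R) (P : R -> Prop) :
  k <> 0 -> locally' (0 : R) P -> locally' (0 : R) (fun t => P (k * t)).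
Proof.
  intros Hk [d Hd]. assert (Hk' := Rabs_pos_lt k Hk).
  exists (mkposreal (d / Rabs k) (Rdiv_lt_0_compat _ _ (cond_pos d) Hk')).
  intros t Ht Ht0. change (Rabs (t - 0) < d / Rabs k) in Ht.
  apply Hd.
  - change (Rabs (k * t - 0) < d). rewrite Rminus_0_r in *. rewrite Rabs_mult.
    apply Rmult_lt_compat_l with (r := Rabs k) in Ht; [|assumption].
    replace (Rabs k * (d / Rabs k)) with (d : R) in Ht by (field; lra). assumption.
  - now apply Rmult_integral_contrapositive_currified.
Qed.

Lemma tanh_is_pseries :
  locally' (0 : R) (fun t : R => is_pseries tanh_coef t (tanh t)).
Proof.
  assert (HB := bernoulliP). unfold bernoulli_gf in HB.
  assert (H4 := locally'_0_scal 4 _ ltac:(lra) HB).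
  assert (H4' := locally'_0_scal (-(4)) _ ltac:(lra) HB).
  assert (H2 := locally'_0_scal 2 _ ltac:(lra) HB).
  assert (H2' := locally'_0_scal (-(2)) _ ltac:(lra) HB).
  assert (H0 : locally' (0 : R) (fun t : R => t <> 0)).
  { exists (mkposreal 1 Rlt_0_1). now intros. }
  generalize (filter_and _ _ H0 (filter_and _ _ (filter_and _ _ H4 H4')
                                   (filter_and _ _ H2 H2'))).
  apply filter_imp. clear. intros t [Ht [[H4 H4'] [H2 H2']]].
  rewrite <- Ropp_mult_distr_l in H4', H2'.
  assert (H := is_pseries_minus _ _ _ _ _
    (is_pseries_comp_scal _ _ _ _ (is_pseries_even_part _ _ _ _ H4 H4'))
    (is_pseries_comp_scal _ _ _ _ (is_pseries_even_part _ _ _ _ H2 H2'))).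
  (* Divide the series of [t * tanh t] by [t]; its constant term vanishes. *)
  apply (is_pseries_decr_1 _ _ (/ t)) in H; [|now apply Rinv_l].
  match type of H with is_pseries _ _ ?l => assert (E : l = tanh t) end.
  { replace (tanh t) with (/ t * (t * tanh t)) by (field; assumption).
    rewrite <- (mul_tanh_gf t Ht).
    unfold scal, plus, opp, PS_minus, PS_plus, PS_opp; simpl.
    unfold mult, plus, opp; simpl. ring. }
  rewrite E in H. revert H. apply is_series_ext. intro n. f_equal.
  unfold PS_decr_1, PS_minus, PS_plus, PS_opp, tanh_coef, plus, opp; simpl. ring.
Qed.

Lemma tanh_coef_Derive_n (n : nat) :
  Derive_n tanh n 0 = tanh_coef n * INR (fact n).
Proof.
  rewrite <- Derive_n_coef.
  - apply Derive_n_ext_loc.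
    generalize (tanh_is_pseries : locally (0 : R) (fun t => t <> 0 -> _)).
    apply filter_imp. intros t H.
    destruct (Req_dec t 0) as [-> | Ht].
    (* The Bernoulli series says nothing at [t = 0]; there the first coefficient
       vanishes because [t * tanh t] has no term in [t]. *)
    + rewrite PSeries_0, tanh_0. unfold tanh_coef. simpl. field.
    + symmetry. now apply is_pseries_unique, H.
  - apply CV_radius_pos_of_locally'. generalize tanh_is_pseries.
    apply filter_imp. intros t H. now exists (tanh t).
Qed.

(** The coefficient [(4^(2n+2) - 2^(2n+2)) B_(2n+2) / (2n+2)!] of [tanh], times
    [(2n+1)!], is the defining formula of [T_(n+1)] up to sign. *)
Lemma tangent_number_tanh (n : nat) :
  tangent_number (S n) = (-1) ^ n * Derive_n tanh (S (2 * n)) 0.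
Proof.
  rewrite tanh_coef_Derive_n. unfold tangent_number, tanh_coef.
  replace (2 * S n)%nat with (S (S (2 * n))) by lia.
  rewrite (fact_simpl (S (2 * n))), mult_INR.
  assert (E1 : (-1) ^ S (S (2 * n)) = 1).
  { replace (S (S (2 * n))) with (2 * S n)%nat by lia. apply pow_1_even. }
  assert (E4 : 4 ^ S (S (2 * n)) = 2 ^ S (S (2 * n)) * 2 ^ S (S (2 * n))).
  { rewrite <- Rpow_mult_distr. f_equal; ring. }
  rewrite E1, E4. change ((-1) ^ S n) with (-1 * (-1) ^ n).
  field. split; [apply INR_fact_neq_0 | apply not_0_INR; lia].
Qed.

(** * The congruences *)

Lemma pow_m1_IZR (n : nat) : (-1) ^ n = IZR (if Nat.even n then 1 else -1).
Proof.
  induction n as [|n IH]; [reflexivity|].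
  rewrite Nat.even_succ, <- Nat.negb_even. simpl pow. rewrite IH.
  destruct (Nat.even n); simpl; lra.
Qed.

(** At [0] the derivative of odd order is [tanh' 0 = 1] modulo 3, so the residue
    is the sign [(-1) ^ n]. *)
Lemma tangent_number_mod3 (n : nat) :
  exists z : Z, tangent_number (S n) = IZR z /\
    (z mod 3 = if Nat.odd (S n) then 1 else 2)%Z.
Proof.
  destruct (Derive_n_tanh_mod3 n) as [q [Kq Dq]].
  destruct (Ztanh_at_0 q Kq) as [k Hk].
  exists ((if Nat.even n then 1 else -1) * (1 + 3 * k))%Z. split.
  - rewrite tangent_number_tanh, Dq, tanh_0, Hk, pow_m1_IZR,
      mult_IZR, plus_IZR, mult_IZR. ring.
  - rewrite Nat.odd_succ. destruct (Nat.even n); symmetry.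
    + apply Z.mod_unique with k; lia.
    + apply Z.mod_unique with (- k - 1)%Z; lia.
Qed.

Lemma tangent_number_even (n : nat) :
  exists z : Z, tangent_number (S (S n)) = IZR z /\ Z.Even z.
Proof.
  destruct (Derive_n_tanh_even (S (2 * n))) as [q [Kq Dq]].
  destruct (Ztanh_at_0 q Kq) as [k Hk].
  exists (2 * ((if Nat.even (S n) then 1 else -1) * k))%Z. split; [|now eexists].
  rewrite tangent_number_tanh.
  replace (S (2 * S n)) with (S (S (S (2 * n)))) by lia.
  rewrite Dq, Hk, pow_m1_IZR, !mult_IZR. ring.
Qed.

Theorem corollary3 :
  (forall n : nat, (2 <= n)%nat ->
     exists z : Z, tangent_number n = IZR z /\ Z.Even z /\ ~ (3 | z)%Z) /\
  (forall n : nat, (1 <= n)%nat ->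
     exists z : Z, tangent_number n = IZR z /\
       (z mod 3 = if Nat.odd n then 1 else 2)%Z).
Proof.
  split.
  - intros [|[|n]] Hn; [lia | lia |].
    destruct (tangent_number_even n) as [z [Hz Ez]].
    destruct (tangent_number_mod3 (S n)) as [z' [Hz' Mz]].
    assert (z' = z) as -> by (apply eq_IZR; congruence).
    exists z. split; [assumption|]. split; [assumption|].
    intro D. apply Z.mod_divide in D; [|lia].
    rewrite D in Mz. destruct (Nat.odd (S (S n))); discriminate.
  - intros [|n] Hn; [lia | apply tangent_number_mod3].
Qed.
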